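(* Let $m=2$. The cost $C(\xi)$ is monotone causal on the simplex $s$ formed by $(x=0,z_1,z_2)$ if $\mathcal{V}_s(x)$ is fully contained in the parallelogram with vertices $0$, $v_1$, $v_2$, and $v_1+v_2$. If this property holds for every $s\in\mathcal{S}(x)$ (i.e., if the entire $\mathcal{V}(x)$ is contained in the union of such parallelograms), then the entire stencil is monotone causal at $x$. If this is the case for all $x\in X$, then Dijkstra's method is applicable.
   Context: $\Omega\subset\mathbb{R}^m$ is open, $S_{m-1}$ is the unit sphere, and $f:\Omega\times S_{m-1}\to\mathbb{R}_+$ is a Lipschitz continuous speed function with $0<F_1\le f\le F_2<\infty$; $q:\partial\Omega\to[0,\infty)$ is Lipschitz. The speed profile at $x$ is $\mathcal{V}(x)=\{f(x,a)a:a\in S_{m-1}\}$. $\Xi_m=\{\xi\in\mathbb{R}^m:\xi_j\ge0,\ \sum_j\xi_j=1\}$. $X$ is a finite grid or simplicial mesh over $\overline\Omega$. For $x\in X\cap\Omega$, the stencil $\mathcal{S}(x)$ is a set of nondegenerate simplexes $s$, each with vertices $x,z_1^s,\dots,z_m^s\in X$ (together covering all directions of motion from $x$). For $\xi\in\Xi_m$ let $\tilde x_\xi=\sum_j\xi_jz^s_j$, $a_\xi=(\tilde x_\xi-x)/|\tilde x_\xi-x|$, $C^s(x,\xi)=|\tilde x_\xi-x|/f(x,a_\xi)$. The semi-Lagrangian discretization (of the Hamilton-Jacobi-Bellman equation $\min_a\{(\nabla u\cdot a)f(x,a)\}+1=0$ with $u=q$ on $\partial\Omega$) is $$U(x)=\min_{s\in\mathcal{S}(x)}\min_{\xi\in\Xi_m}\Bigl\{C^s(x,\xi)+\sum_{j=1}^m\xi_jU(z_j^s)\Bigr\},\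 x\in X\cap\Omega;\qquad U(x)=q(x),\ x\in X\cap\partial\Omega.$$ It is the dynamic programming system of a stochastic shortest path problem in which at $x$ one chooses $(s,\xi)$, pays $C^s(x,\xi)$ and moves to $z^s_j$ with probability $\xi_j$ (boundary nodes move to a target $t$ at cost $q$). As a standing assumption, from every node some policy reaches the target with probability 1. Notation for a single simplex $s$ (coordinates centered so that $x=0$, vertices $0,z_1,\dots,z_m$): $C(\xi)=C^s(x,\xi)$; $f_j=f(x,z_j/|z_j|)$ and $v_j=f_jz_j/|z_j|$ are the speed and velocity toward $z_j$; $\mathcal{V}_s=\{v\in\mathcal{V}(x): v=\sum_j\theta_jv_j,\ \text{all }\theta_j\ge0\}$. $C$ (or the simplex $s$) is monotone causal if for arbitrary vertex values $W_1,\dots,W_m\in\mathbb{R}$ there is a minimizer $\xi^*\in\Xi_m$ of $C(\xi)+\sum_j\xi_jW_j$ such that the minimum value is strictly greater than $W_j$ for every $j$ with $\xi_j^*>0$. The stencil is monotone causal at $x$ if every $s\in\mathcal{S}(x)$ is. Dijkstra's method for the discretized system: maintain tentative labels $V$, a set $K\subset X$ of accepted nodes and $L=X\setminus K$; initially $K=\emptyset$, $V=q$ on $X\cap\partial\Omega$ and $V=+\infty$ elsewhere. Repeatedly move to $K$ the node $\bar x\in L$ with smallest finite label, and for each $x\in L$ having $\bar x$ as a vertex of some simplex in $\mathcal{S}(x)$ set $V(x)$ to the minimum of its current value and of $C^s(x,\xi)+\sum_j\xi_jV(z_j^s)$ over all $s\in\mathcal{S}(x)$, $\xi\in\Xi_m$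 with $\bar x\in\{z_j^s:\xi_j>0\}\subset K$. It is applicable if its output is the correct value function $U$.
   Formalization: The ''i.e.'' (V(x) contained in the union of the parallelograms implies the property for every s) is stated only for stencils whose simplexes do not overlap, since it fails for overlapping ones; the claim under the property for every s is stated for all stencils. *)

(* Defs.v *)
From mathcomp Require Import all_boot all_order all_algebra finmap.
From mathcomp Require Import all_classical all_reals all_analysis.

Set Implicit Arguments.
Unset Strict Implicit.
Unset Printing Implicit Defensive.

Import Order.TTheory GRing.Theory Num.Theory.
Import numFieldNormedType.Exports.

Local Open Scope classical_set_scope.
Local Open Scope ring_scope.

Definition boundary (T : topologicalType) (A : set T) : set T :=
  closure A `\` interior A.

Definition is_min (R : realType) (A : set R) (r : R) : Prop :=
  A r /\ lbound A r.

Section Geometry.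
Context {R : realType} {m : nat}.
Implicit Types (x v : 'rV[R]_m) (z : 'I_m -> 'rV[R]_m) (xi : 'rV[R]_m).

(* The library norm on row vectors is the sup norm. *)
Definition enorm v : R := Num.sqrt (\sum_(i < m) v 0 i ^+ 2).

Definition sphere : set 'rV[R]_m := [set a | enorm a = 1].

Definition direction v : 'rV[R]_m := (enorm v)^-1 *: v.

Definition Xi : set 'rV[R]_m :=
  [set xi | (forall j, 0 <= xi 0 j) /\ \sum_(j < m) xi 0 j = 1].

Definition nondegenerate_simplex x z : bool := row_free (\matrix_(j < m) (z j - x)).

Definition bary z xi : 'rV[R]_m := \sum_(j < m) xi 0 j *: z j.

Section Speed.
Variable f : 'rV[R]_m -> 'rV[R]_m -> R.

Definition speed_profile x : set 'rV[R]_m := [set f x a *: a | a in sphere].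

Definition cost x z xi : R :=
  enorm (bary z xi - x) / f x (direction (bary z xi - x)).

Definition velocity x z (j : 'I_m) : 'rV[R]_m :=
  f x (direction (z j - x)) *: direction (z j - x).

Definition simplex_profile x z : set 'rV[R]_m :=
  [set v | speed_profile x v /\
     exists theta : 'I_m -> R, (forall j, 0 <= theta j) /\
       v = \sum_(j < m) theta j *: velocity x z j].

Definition monotone_causal x z : Prop :=
  forall W : 'I_m -> R, exists xi : 'rV[R]_m,
    let value xi' := cost x z xi' + \sum_(j < m) xi' 0 j * W j in
    [/\ Xi xi, forall xi', Xi xi' -> value xi <= value xi'
      & forall j, 0 < xi 0 j -> W j < value xi].

End Speed.
End Geometry.

(* Parallelogram with vertices 0, v1, v2 and v1 + v2. *)
Definition parallelogram (R : realType) (m : nat) (v1 v2 : 'rV[R]_m) :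
    set 'rV[R]_m :=
  [set v | exists t1 t2 : R,
     [/\ 0 <= t1 <= 1, 0 <= t2 <= 1 & v = t1 *: v1 + t2 *: v2]].

Definition simplex_parallelogram (R : realType)
    (f : 'rV[R]_2 -> 'rV[R]_2 -> R) (x : 'rV[R]_2) (z : 'I_2 -> 'rV[R]_2) :
    set 'rV[R]_2 :=
  parallelogram (velocity f x z ord0) (velocity f x z ord_max).

Section Discretization.
Context {R : realType} {m : nat}.
Variables (Omega : set 'rV[R]_m) (X : {fset 'rV[R]_m}).

Definition interior_node (x : X) : bool := fsval x \in Omega.

(* A simplex of the stencil at x is given by its vertices other than x. *)
Definition simplex := {ffun 'I_m -> X}.

Definition vertices (s : simplex) (j : 'I_m) : 'rV[R]_m := fsval (s j).

Variable S : X -> {set simplex}.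

Definition stencil_nondegenerate (x : X) : Prop :=
  forall s, s \in S x -> nondegenerate_simplex (fsval x) (vertices s).

Definition stencil_covers (x : X) : Prop :=
  forall a, sphere a -> exists s, s \in S x /\
    exists theta : 'I_m -> R, (forall j, 0 <= theta j) /\
      a = \sum_(j < m) theta j *: (vertices s j - fsval x).

(* No direction is interior to the cones of two different simplexes. *)
Definition stencil_nonoverlapping (x : X) : Prop :=
  forall s s', s \in S x -> s' \in S x -> s <> s' ->
  forall theta theta' : 'I_m -> R,
    (forall j, 0 < theta j) -> (forall j, 0 < theta' j) ->
    \sum_(j < m) theta j *: (vertices s j - fsval x) <>
    \sum_(j < m) theta' j *: (vertices s' j - fsval x).

Definition control : Type := (simplex * 'rV[R]_m)%type.

Definition policy : Type := nat -> X -> control.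

Definition admissible (pi : policy) : Prop :=
  forall n x, interior_node x -> (pi n x).1 \in S x /\ Xi (pi n x).2.

(* Probability that, starting from x, the target has not been reached after
   N steps; a boundary node moves to the target in one step. *)
Fixpoint unreached (N : nat) (pi : policy) (x : X) : R :=
  if N is N'.+1 then
    if interior_node x then
      let: (s, xi) := pi 0%N x in
      \sum_(j < m) xi 0 j * unreached N' (fun n => pi n.+1) (s j)
    else 0
  else 1.

Definition reaches_target (pi : policy) (x : X) : Prop :=
  (unreached N pi x @[N --> \oo] --> (0 : R)).

Variables (f : 'rV[R]_m -> 'rV[R]_m -> R) (q : 'rV[R]_m -> R).

Definition stencil_monotone_causal (x : X) : Prop :=
  forall s, s \in S x -> monotone_causal f (fsval x) (vertices s).

Definition discrete_HJB (U : X -> R) : Prop :=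
  (forall x, interior_node x ->
     is_min [set r | exists s xi, [/\ s \in S x, Xi xi &
               r = cost f (fsval x) (vertices s) xi
                   + \sum_(j < m) xi 0 j * U (s j)]] (U x)) /\
  (forall x, boundary Omega (fsval x) -> U x = q (fsval x)).

(* Expected cost of the first N steps of pi, starting from x. *)
Fixpoint expected_cost (N : nat) (pi : policy) (x : X) : R :=
  if N is N'.+1 then
    if interior_node x then
      let: (s, xi) := pi 0%N x in
      cost f (fsval x) (vertices s) xi
      + \sum_(j < m) xi 0 j * expected_cost N' (fun n => pi n.+1) (s j)
    else q (fsval x)
  else 0.

Definition policy_cost (pi : policy) (x : X) : \bar R :=
  limn (fun N => (expected_cost N pi x)%:E).

Definition optimal_cost (x : X) : \bar R :=
  ereal_inf [set policy_cost pi x | pi in admissible].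

Definition labels : Type := X -> \bar R.

(* The accepted set K and the tentative labels V. *)
Definition dijkstra_state : Type := ({set X} * labels)%type.

Definition dijkstra_init : dijkstra_state :=
  (finset.set0,
   fun x => if interior_node x then +oo%E else (q (fsval x))%:E).

(* Values offered at x when xbar has just joined K. In \bar R, 0 * +oo = 0,
   so vertices of zero weight are ignored even when their label is infinite. *)
Definition update_values (K : {set X}) (V : labels) (xbar x : X) :
    set (\bar R) :=
  [set e | exists s xi, [/\ s \in S x, Xi xi,
     exists j, 0 < xi 0 j /\ s j = xbar,
     forall j, 0 < xi 0 j -> s j \in K &
     e = ((cost f (fsval x) (vertices s) xi)%:E
          + \sum_(j < m) (xi 0 j)%:E * V (s j))%E]].

(* The weights with xbar in the support do not form a closed set; the infimum
   of the offered values and the current label plays the role of the minimum,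
   the limiting weights having been considered at earlier updates. *)
Definition dijkstra_accept (st : dijkstra_state) (xbar : X) : dijkstra_state :=
  let K := finset.setU (finset.set1 xbar) st.1 in
  (K, fun x => if interior_node x && (x \notin K)
               then mine (st.2 x) (ereal_inf (update_values K st.2 xbar x))
               else st.2 x).

Inductive dijkstra_reachable : dijkstra_state -> Prop :=
| dijkstra_start : dijkstra_reachable dijkstra_init
| dijkstra_step st xbar : dijkstra_reachable st ->
    xbar \notin st.1 -> (st.2 xbar < +oo)%E ->
    (forall y, y \notin st.1 -> (st.2 xbar <= st.2 y)%E) ->
    dijkstra_reachable (dijkstra_accept st xbar).

(* Every step enlarges K, hence every run stops. *)
Definition dijkstra_output (V : labels) : Prop :=
  exists K : {set X}, dijkstra_reachable (K, V) /\
    forall y, y \notin K -> V y = +oo%E.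

(* The value function U is the solution of the discretized system, and the
   optimal cost of the stochastic shortest path problem. Ties between labels
   make the run nondeterministic: all outputs have to be U. *)
Definition dijkstra_applicable : Prop :=
  exists U : X -> R,
    [/\ discrete_HJB U,
        forall U', discrete_HJB U' -> U' =1 U,
        forall x, optimal_cost x = (U x)%:E,
        exists V, dijkstra_output V
      & forall V, dijkstra_output V -> forall x, V x = (U x)%:E].

End Discretization.

(* Main.v *)
Require Import Defs.
From mathcomp Require Import all_boot all_order all_algebra finmap.
From mathcomp Require Import all_classical all_reals all_analysis.
From mathcomp Require Import lra.

(** The causality criterion is a statement about the gauge of the speed profile.
    The point of the profile in the direction of [sum_j xi_j (z_j - x)] has the
    coordinates [xi_j C(e_j) / C(xi)] along the velocities [v_j], so the
    profile of the simplex lies in the parallelogram exactly when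
    [xi_j C(e_j) <= C(xi)] for both [j] ([displacement_profile],
    [cost_ge_component]). In the plane this is enough for causality: an optimal
    [xi] is at least as good as moving straight to the vertex with the smaller
    value, and this bounds the difference of the two values by the cost of the
    move ([causal_of_cost_ge_component]). A minimizer exists because the cost is
    continuous on the compact set of weights ([cost_minimizer]).

    That the profile lies in the union of the parallelograms means the same as
    the condition on every simplex: the cones of the stencil cover all
    directions, and a point of the profile interior to one cone of a
    nonoverlapping stencil is in no other cone, while a point on an edge ray
    is one of the velocities ([nonoverlapping_interior], [profile_ray]).

    The applicability of Dijkstra's method uses causality alone, in any
    dimension, and rests on two facts.

    Every solution [U] of the discretized equation is the optimal cost of the
    shortest path problem, which also gives uniqueness ([optimal_cost_value]).
    The policy made of causal minimizers lowers [U] at every step, so it stops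
    after boundedly many steps and costs [U] ([causal_policy]). Conversely, the
    first [N] steps of any policy cost at least [U] minus a multiple of the
    probability [p_N] of not having stopped, and at least [N p_N] times the
    smallest cost of a move; so either the total cost is infinite or [p_N]
    tends to zero ([value_le_policy_cost]).

    Every output of Dijkstra's method is a solution ([dijkstra_output_HJB]).
    During a run, the label of a node is the infimum of the values of all moves
    into accepted nodes, and labels are accepted in nondecreasing order
    ([invariant_accept]). Both survive the acceptance of a node [xbar] since a
    move whose value is less than the label of [xbar] can be replaced, by
    causality, by a move which is no more expensive and does not use [xbar]
    ([causal_offer]). All nodes are accepted in the end, for otherwise no policy
    would lead out of the set of the remaining ones ([dijkstra_accepts_all]). *)

Set Implicit Arguments.
Unset Strict Implicit.
Unset Printing Implicit Defensive.

Import Order.TTheory GRing.Theory Num.Theory.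
Import numFieldNormedType.Exports.

Local Open Scope classical_set_scope.
Local Open Scope ring_scope.

(** * Averages with barycentric weights *)

Section Averages.
Context {R : realType} {m : nat}.
Implicit Types (xi : 'rV[R]_m) (A B : 'I_m -> R) (c : R).

Lemma Xi_support xi : Xi xi -> exists j, 0 < xi 0 j.
Proof.
move=> [xi0 xi1]; apply/existsP; apply: contraT => /existsPn noj.
suff /eqP : (\sum_(j < m) xi 0 j : R) = 0 by rewrite xi1 oner_eq0.
by apply: big1 => j _; apply/eqP; rewrite eq_le xi0 leNgt noj.
Qed.

Lemma Xi_delta (j : 'I_m) : Xi (delta_mx 0 j : 'rV[R]_m).
Proof.
split=> [i|]; first by rewrite mxE ler0n.
rewrite (bigD1 j) //= mxE !eqxx big1 ?addr0 // => i ij.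
by rewrite mxE (negPf ij) andbF.
Qed.

Lemma weighted_sum_le xi A B : Xi xi ->
  (forall j, 0 < xi 0 j -> A j <= B j) ->
  \sum_(j < m) xi 0 j * A j <= \sum_(j < m) xi 0 j * B j.
Proof.
move=> [xi0 _] AB; apply: ler_sum => j _.
have := xi0 j; rewrite le_eqVlt => /predU1P[<-|xij]; first by rewrite !mul0r.
by rewrite ler_pM2l // AB.
Qed.

Lemma weighted_sum_cst xi c : Xi xi -> \sum_(j < m) xi 0 j * c = c.
Proof. by move=> [_ xi1]; rewrite -mulr_suml xi1 mul1r. Qed.

Lemma eq_weighted_sum xi A B : Xi xi ->
  (forall j, 0 < xi 0 j -> A j = B j) ->
  \sum_(j < m) xi 0 j * A j = \sum_(j < m) xi 0 j * B j.
Proof.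
move=> Xxi AB; apply/le_anti/andP.
by split; apply: weighted_sum_le => // j /AB->.
Qed.

(** Vertices of weight zero do not count, whatever their label. *)
Lemma weighted_sum_EFin xi (E : 'I_m -> \bar R) A : Xi xi ->
  (forall j, 0 < xi 0 j -> E j = (A j)%:E) ->
  (\sum_(j < m) (xi 0 j)%:E * E j)%E = (\sum_(j < m) xi 0 j * A j)%:E.
Proof.
move=> [xi0 _] EA; rewrite -sumEFin; apply: eq_bigr => j _.
have := xi0 j; rewrite le_eqVlt => /predU1P[<-|xij].
  by rewrite mul0e mul0r.
by rewrite EA.
Qed.

End Averages.

(** * The discretized equation as a shortest path problem *)

Section ShortestPath.
Context {R : realType} {m : nat}.
Variables (Omega : set 'rV[R]_m) (X : {fset 'rV[R]_m}).
Variable S : X -> {set simplex X}.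
Variables (f : 'rV[R]_m -> 'rV[R]_m -> R) (q : 'rV[R]_m -> R).
Implicit Types (x : X) (s : simplex X) (xi : 'rV[R]_m) (U : X -> R).
Implicit Types (pi : policy X) (V : labels X) (K : {set X}).

Hypothesis causal :
  forall x, interior_node Omega x -> stencil_monotone_causal S f x.
Hypothesis q_ge0 : forall x, ~~ interior_node Omega x -> 0 <= q (fsval x).

Notation interior_node := (interior_node Omega).

Definition move_value U x s xi : R :=
  cost f (fsval x) (vertices s) xi + \sum_(j < m) xi 0 j * U (s j).

Lemma unreached_interior N pi x : interior_node x ->
  unreached Omega N.+1 pi x =
  \sum_(j < m) (pi 0%N x).2 0 j *
    unreached Omega N (fun n => pi n.+1) ((pi 0%N x).1 j).
Proof. by move=> /= ->; case: (pi 0%N x). Qed.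

Lemma expected_cost_interior N pi x : interior_node x ->
  expected_cost Omega f q N.+1 pi x =
  move_value (expected_cost Omega f q N (fun n => pi n.+1)) x
    (pi 0%N x).1 (pi 0%N x).2.
Proof. by move=> /= ->; case: (pi 0%N x). Qed.

Lemma admissible_shift pi :
  admissible Omega S pi -> admissible Omega S (fun n => pi n.+1).
Proof. by move=> api n x; apply: api. Qed.

(** With equal vertex values, causality says that the cheapest way to leave
    [x] through a given simplex has a positive cost; there are finitely many
    simplexes. *)
Lemma cost_lower_bound : exists2 d : R, 0 < d &
  forall x s xi, interior_node x -> s \in S x -> Xi xi ->
    d <= cost f (fsval x) (vertices s) xi.
Proof.
have /choice[d dP] : forall p : X * simplex X, exists d : R, 0 < d /\
    (interior_node p.1 -> p.2 \in S p.1 -> forall xi, Xi xi ->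
      d <= cost f (fsval p.1) (vertices p.2) xi).
  move=> [x s] /=; have [xO|] := boolP (interior_node x); last by exists 1.
  have [sx|] := boolP (s \in S x); last by exists 1.
  have [xi [Xxi ximin xilt]] := causal xO sx (fun=> 0).
  have [j /xilt] := Xi_support Xxi.
  rewrite weighted_sum_cst // addr0 => c_gt0.
  exists (cost f (fsval x) (vertices s) xi); split=> // _ _ xi' Xxi'.
  by have := ximin _ Xxi'; rewrite !weighted_sum_cst // !addr0.
exists (\big[Order.min/1]_p d p).
  by apply: lt_bigmin => // p _; case: (dP p).
move=> x s xi xO sx Xxi; apply: (le_trans (bigmin_le _ (x, s) _)).
by case: (dP (x, s)) => _; apply.
Qed.

Lemma unreached_01 N pi x : admissible Omega S pi ->
  0 <= unreached Omega N pi x <= 1.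
Proof.
elim: N pi x => [|N IH] pi x api; first by rewrite /= ler01 lexx.
have [xO|xO] := boolP (interior_node x); last first.
  by rewrite /= (negPf xO) lexx ler01.
rewrite unreached_interior //; have [_ Xxi] := api 0%N x xO.
have {}IH j := andP (IH _ ((pi 0%N x).1 j) (admissible_shift api)).
apply/andP; split.
  rewrite -[leLHS](weighted_sum_cst 0 Xxi); apply: weighted_sum_le => // j _.
  by case: (IH j).
rewrite -[leRHS](weighted_sum_cst 1 Xxi); apply: weighted_sum_le => // j _.
by case: (IH j).
Qed.

(** Every step which does not reach the target costs at least [d]. *)
Lemma unreached_le_cost d N pi x : admissible Omega S pi -> 0 <= d ->
  (forall x s xi, interior_node x -> s \in S x -> Xi xi ->
    d <= cost f (fsval x) (vertices s) xi) ->
  d * N%:R * unreached Omega N pi x <= expected_cost Omega f q N pi x.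
Proof.
move=> api d0 dcost; elim: N pi x api => [|N IH] pi x api.
  by rewrite /= mulr0 mul0r.
have [xO|xO] := boolP (interior_node x); last first.
  by rewrite /= (negPf xO) mulr0 q_ge0.
have [sx Xxi] := api 0%N x xO.
have /andP[_ u1] := unreached_01 N.+1 x api.
rewrite -natr1 mulrDr mulr1 mulrDl addrC expected_cost_interior //.
apply: lerD; first by apply: le_trans (dcost _ _ _ xO sx Xxi); rewrite ler_piMr.
rewrite unreached_interior // mulr_sumr.
under eq_bigr do rewrite mulrCA.
by apply: weighted_sum_le => // j _; apply/IH/admissible_shift.
Qed.

Lemma expected_cost_ge0 N pi x : admissible Omega S pi ->
  0 <= expected_cost Omega f q N pi x.
Proof.
move=> api; have [d d0 dcost] := cost_lower_bound.
apply: le_trans (unreached_le_cost N x api (ltW d0) dcost).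
by have /andP[? _] := unreached_01 N x api; rewrite !mulr_ge0 // ltW.
Qed.

Lemma expected_cost_nondecreasing pi x : admissible Omega S pi ->
  {homo (fun N => (expected_cost Omega f q N pi x)%:E) :
    n p / (n <= p)%N >-> (n <= p)%E}.
Proof.
move=> api; apply: homo_leq => [y|? ? ?|N]; first exact: lexx.
  exact: le_trans.
rewrite lee_fin; elim: N pi x api => [|N IH] pi x api.
  exact: expected_cost_ge0.
have [xO|xO] := boolP (interior_node x); last by rewrite /= (negPf xO).
have [_ Xxi] := api 0%N x xO.
rewrite !expected_cost_interior // lerD2l; apply: weighted_sum_le => // j _.
exact/IH/admissible_shift.
Qed.

Section Verification.
Variable U : X -> R.
Hypothesis U_interior : forall x, interior_node x ->
  is_min [set r | exists s xi, [/\ s \in S x, Xi xi & r = move_value U x s xi]]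
    (U x).
Hypothesis U_boundary : forall x, ~~ interior_node x -> U x = q (fsval x).

(** [U] is at most the one-step cost plus the average of [U] at the next node,
    for any move; iterating this along [N] steps leaves the values of [U] at
    the nodes reached without having stopped. *)
Lemma value_le_expected_cost M N pi x : admissible Omega S pi ->
  (forall y, U y <= M) ->
  U x <= expected_cost Omega f q N pi x + M * unreached Omega N pi x.
Proof.
move=> api UM; elim: N pi x api => [|N IH] pi x api.
  by rewrite /= add0r mulr1.
have [xO|xO] := boolP (interior_node x); last first.
  by rewrite /= (negPf xO) mulr0 addr0 U_boundary.
have [sx Xxi] := api 0%N x xO.
have [_ /(_ (move_value U x (pi 0%N x).1 (pi 0%N x).2))] := U_interior xO.
move=> /(_ _)/le_trans; apply; first by exists (pi 0%N x).1, (pi 0%N x).2.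
rewrite expected_cost_interior // unreached_interior // /move_value.
rewrite -addrA lerD2l mulr_sumr -big_split /=.
under [leRHS]eq_bigr do rewrite mulrCA -mulrDr.
by apply: weighted_sum_le => // j _; apply/IH/admissible_shift.
Qed.

(** If the expected costs stay below [U x], then the cost [d] of each step keeps
    [N] times the probability [unreached N] bounded, so the remainder
    [M * unreached N] above tends to zero, and the costs reach [U x] after
    all. *)
Lemma value_le_policy_cost pi x : admissible Omega S pi ->
  ((U x)%:E <= policy_cost Omega f q pi x)%E.
Proof.
move=> api; have [d d0 dcost] := cost_lower_bound.
have /ereal_nondecreasing_cvgn/cvg_lim := expected_cost_nondecreasing x api.
rewrite /policy_cost => ->//; rewrite leNgt; apply/negP => supltU.
set L := ereal_sup _ in supltU.
have EL N : ((expected_cost Omega f q N pi x)%:E <= L)%E.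
  by apply: ereal_sup_ubound; exists N.
case: L supltU EL => [l| |] //=; last by move=> _ /(_ 0%N).
rewrite lte_fin => lU EL.
pose M := \sum_(y : X) `|U y|.
have UM y : U y <= M.
  rewrite /M (bigD1 y) //=; apply: (le_trans (ler_norm _)).
  by rewrite lerDl sumr_ge0.
have l0 : 0 <= l by have := EL 0%N; rewrite lee_fin.
have M0 : 0 <= M by rewrite sumr_ge0.
have key N : (U x - l) * (d * N%:R) <= M * l.
  have := EL N; rewrite lee_fin => El.
  have := value_le_expected_cost N x api UM.
  have := unreached_le_cost N x api (ltW d0) dcost.
  have /andP[u0 u1] := unreached_01 N x api.
  set e := expected_cost _ _ _ _ _ _ in El *.
  set u := unreached _ _ _ _ in u0 u1 * => due Ueu.
  apply: (@le_trans _ _ (M * u * (d * N%:R))).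
    by rewrite ler_wpM2r ?mulr_ge0 ?(ltW d0)// lerBlDl (le_trans Ueu)// lerD2r.
  rewrite -mulrA ler_wpM2l // (le_trans _ El) //.
  by apply: le_trans due; rewrite mulrC.
have /archi_boundP : 0 <= M * l / ((U x - l) * d).
  by apply/divr_ge0; apply/mulr_ge0; rewrite // ?subr_ge0 ltW.
rewrite ltr_pdivrMr ?mulr_gt0 ?subr_gt0 // [ltRHS]mulrC ltNge => /negP.
by apply; rewrite -[leLHS]mulrA; apply: key.
Qed.

Lemma causal_optimal_move x : interior_node x ->
  exists c : control X, [/\ c.1 \in S x, Xi c.2, U x = move_value U x c.1 c.2
    & forall j, 0 < c.2 0 j -> U (c.1 j) < U x].
Proof.
move=> xO; have [[s [xi [sx Xxi UE]]] Umin] := U_interior xO.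
have [xi' [Xxi' xi'min xi'lt]] := causal xO sx (U \o s).
have UE' : U x = move_value U x s xi'.
  apply/le_anti/andP; split; first by apply: Umin; exists s, xi'.
  by rewrite UE; apply: xi'min.
by exists (s, xi'); split=> //= j /xi'lt; rewrite UE'.
Qed.

(** A causal minimizer moves only to nodes of smaller value, hence a policy
    made of causal minimizers reaches the boundary, along every sample path,
    in at most as many steps as there are nodes. *)
Lemma causal_policy : exists2 pi, admissible Omega S pi &
  forall x, policy_cost Omega f q pi x = (U x)%:E.
Proof.
have /choice[mu muP] : forall x, exists c : control X, interior_node x ->
    [/\ c.1 \in S x, Xi c.2, U x = move_value U x c.1 c.2
      & forall j, 0 < c.2 0 j -> U (c.1 j) < U x].
  move=> x; have [/causal_optimal_move[c cP]|_] := boolP (interior_node x).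
    by exists c.
  by exists ([ffun=> x], 0).
exists (fun=> mu) => [n x /muP[]//|x].
pose rank y := #|[set z | (U z < U y)%R]%SET|.
have exact N y : (rank y < N)%N -> expected_cost Omega f q N (fun=> mu) y = U y.
  elim: N y => // N IH y rkN.
  have [yO|yO] := boolP (interior_node y); last first.
    by rewrite /= (negPf yO) U_boundary.
  have [sy Xxi UE Ult] := muP _ yO.
  rewrite expected_cost_interior // UE; congr +%R.
  apply: eq_weighted_sum => // j /Ult Uj; apply: IH.
  apply: leq_trans (_ : rank y <= N)%N; last by rewrite -ltnS.
  apply/proper_card/properP; split.
    by apply/fintype.subsetP => z; rewrite !inE => /lt_trans; apply.
  by exists ((mu y).1 j); rewrite inE ?ltxx.
apply: lim_near_cst; first exact: ereal_hausdorff.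
by exists (rank x).+1 => // N /= rkN; rewrite exact.
Qed.

Lemma optimal_cost_value x : optimal_cost Omega S f q x = (U x)%:E.
Proof.
apply/le_anti/andP; split.
  have [pi api piU] := causal_policy.
  by apply: ereal_inf_lbound; exists pi.
by apply: le_ereal_inf_tmp => _ [pi api <-]; apply: value_le_policy_cost.
Qed.

End Verification.

(** * Dijkstra's method *)

Definition label_value V x s xi : \bar R :=
  ((cost f (fsval x) (vertices s) xi)%:E +
   \sum_(j < m) (xi 0 j)%:E * V (s j))%E.

(** A single update of the method considers only the moves that use the node
    just accepted; over a run they add up to all moves into accepted nodes. *)
Definition offers K V x : set (\bar R) :=
  [set e | exists s xi, [/\ s \in S x, Xi xi,
     forall j, 0 < xi 0 j -> s j \in K & e = label_value V x s xi]].

Lemma label_valueE V U x s xi : Xi xi ->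
  (forall j, 0 < xi 0 j -> V (s j) = (U (s j))%:E) ->
  label_value V x s xi = (move_value U x s xi)%:E.
Proof.
move=> Xxi VU; rewrite /label_value EFinD; congr (_ + _)%E.
exact: (weighted_sum_EFin (A := fun j => U (s j))).
Qed.

Lemma eq_label_value V V' x s xi : Xi xi ->
  (forall j, 0 < xi 0 j -> V (s j) = V' (s j)) ->
  label_value V x s xi = label_value V' x s xi.
Proof.
move=> [xi0 _] VV'; rewrite /label_value; congr (_ + _)%E.
apply: eq_bigr => j _.
have := xi0 j; rewrite le_eqVlt => /predU1P[<-|xij]; first by rewrite !mul0e.
by rewrite VV'.
Qed.

(** Causality turns any move into accepted nodes into one which is at least
    as cheap and uses accepted nodes of smaller labels only: the vertices out
    of [K] are given the value of the original move, which excludes them from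
    the support of a causal minimizer. *)
Lemma causal_offer K V x e : interior_node x ->
  (forall z, z \in K -> V z \is a fin_num) -> offers K V x e ->
  exists2 e', (e' <= e)%E & offers [set z in K | (V z < e')%E]%SET V x e'.
Proof.
move=> xO Vfin [s [xi [sx Xxi xiK ->]]].
have VU z : z \in K -> V z = (fine (V z))%:E by move=> /Vfin/fineK->.
pose U z := fine (V z); pose r := move_value U x s xi.
have rE : label_value V x s xi = r%:E.
  by apply: label_valueE => // j /xiK/VU.
pose W j := if s j \in K then U (s j) else r.
have [xi' [Xxi' xi'min xi'lt]] := causal xO sx W.
set r' := (_ + _) in xi'lt.
have r'r : r' <= r.
  apply: le_trans (xi'min _ Xxi) _; rewrite lerD2l.
  by apply: weighted_sum_le => // j /xiK sjK; rewrite /W sjK.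
have xi'K j : 0 < xi' 0 j -> (s j \in K) && (U (s j) < r').
  move=> /xi'lt; rewrite /W; case: ifP => // _ /lt_le_trans/(_ r'r).
  by rewrite ltxx.
exists r'%:E; first by rewrite rE lee_fin.
exists s, xi'; split=> // [j /xi'K/andP[sjK Ult]|].
  by rewrite inE sjK VU ?lte_fin.
rewrite (label_valueE (U := U)) //; last by move=> j /xi'K/andP[/VU].
congr (_%:E); congr (_ + _); apply: eq_weighted_sum => // j /xi'K/andP[sjK _].
by rewrite /W sjK.
Qed.

Lemma offersS K K' V x : K \subset K' -> offers K V x `<=` offers K' V x.
Proof.
move=> /fintype.subsetP KK' e [s [xi [sx Xxi xiK ->]]].
by exists s, xi; split=> // j /xiK/KK'.
Qed.

(** Nodes are accepted in the order of their labels, so that a label accepted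
    early is not improved by the nodes accepted later: [label_inf] holds for
    accepted nodes as well. *)
Record invariant (st : dijkstra_state X) : Prop := Invariant {
  label_boundary : forall x, ~~ interior_node x -> st.2 x = (q (fsval x))%:E;
  label_inf : forall x, interior_node x ->
    st.2 x = ereal_inf (offers st.1 st.2 x);
  label_order : forall z y, z \in st.1 -> y \notin st.1 ->
    (st.2 z <= st.2 y)%E;
  label_fin : forall z, z \in st.1 -> st.2 z \is a fin_num;
  label_gtNy : forall y, (-oo < st.2 y)%E }.

Lemma invariant_init : invariant (dijkstra_init Omega X q).
Proof.
split=> [x xO|x xO|z y|z|y] /=; rewrite ?inE //.
- by rewrite (negPf xO).
- rewrite xO; apply/esym/ereal_inf_pinfty => e [s [xi [_ /Xi_support[j xij]]]].
  by move=> /(_ j xij); rewrite inE.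
- by case: ifP => _; rewrite ?ltNyr // ltNy0.
Qed.

Section Accept.
Variables (K : {set X}) (V : labels X) (xbar : X).
Hypothesis inv : invariant (K, V).
Hypothesis xbar_notin : xbar \notin K.
Hypothesis xbar_lt : (V xbar < +oo)%E.
Hypothesis xbar_min : forall y, y \notin K -> (V xbar <= V y)%E.

Let K' := (xbar |: K)%SET.
Let V' := (dijkstra_accept Omega S f (K, V) xbar).2.

Let K'_fin z : z \in K' -> V z \is a fin_num.
Proof.
rewrite in_setU1 => /predU1P[->|/(label_fin inv)//].
by rewrite fin_numElt xbar_lt (label_gtNy inv).
Qed.

Let K'_le z : z \in K' -> (V z <= V xbar)%E.
Proof.
by rewrite in_setU1 => /predU1P[->|/(label_order inv)]//; apply.
Qed.

Let V'_in z : z \in K' -> V' z = V z.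
Proof. by move=> zK'; rewrite /V' /= zK' andbF. Qed.

Let offersV' x : offers K' V' x = offers K' V x.
Proof.
apply/seteqP; split=> e [s [xi [sx Xxi xiK' ->]]]; exists s, xi; split=> //;
  by apply: eq_label_value => // j /xiK'/V'_in.
Qed.

(** The causal replacement of an offer below the label of the new node does
    not use this node. *)
Let offer_below x e : interior_node x -> offers K' V x e -> (e < V xbar)%E ->
  exists2 e', (e' <= e)%E & offers K V x e'.
Proof.
move=> xO offe elt; have [e' e'e offe'] := causal_offer xO K'_fin offe.
exists e' => //; apply: offersS offe'; apply/fintype.subsetP => z.
rewrite !inE => /andP[/predU1P[->|//] /lt_le_trans/(_ e'e)/(lt_trans elt)].
by rewrite ltxx.
Qed.

Let V_inf x : interior_node x -> V x = ereal_inf (offers K V x).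
Proof. exact: label_inf inv x. Qed.

Let min_le_offer x e : interior_node x -> offers K' V x e ->
  (Order.min (V x) (V xbar) <= e)%E.
Proof.
move=> xO offe; rewrite ge_min; have [_|elt] := leP (V xbar) e.
  by rewrite orbT.
have [e' e'e offe'] := offer_below xO offe elt.
by rewrite (V_inf xO) (le_trans (ereal_inf_lbound offe') e'e).
Qed.

Let update_offers x : update_values S f K' V xbar x `<=` offers K' V x.
Proof. by move=> e [s [xi [sx Xxi _ xiK' ->]]]; exists s, xi. Qed.

Let offersK' x e : offers K' V x e ->
  offers K V x e \/ update_values S f K' V xbar x e.
Proof.
move=> [s [xi [sx Xxi xiK' ->]]].
have [[j xij]|/forallNP noxbar] := pselect (exists j, 0 < xi 0 j /\ s j = xbar).
  by right; exists s, xi; split=> //; exists j.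
left; exists s, xi; split=> // j xij; have := xiK' j xij.
by rewrite in_setU1 => /predU1P[sj|//]; case: (noxbar j).
Qed.

Let K'_notin y : y \notin K' -> (V xbar <= V y)%E.
Proof. by rewrite in_setU1 negb_or => /andP[_ /xbar_min]. Qed.

Let order' y : y \notin K' -> (V xbar <= V' y)%E.
Proof.
move=> yK'; rewrite /V' /= yK' andbT; have Vy := K'_notin yK'.
case: ifP => // yO; rewrite le_min Vy.
apply: le_ereal_inf_tmp => e /update_offers.
by move=> /(min_le_offer yO); rewrite (min_idPr Vy).
Qed.

Lemma invariant_accept : invariant (K', V').
Proof.
split=> [x xO|x xO|z y|z|y] /=.
- by rewrite /V' /= (negPf xO); apply: label_boundary inv x xO.
- rewrite offersV'; have [xK'|xK'] := boolP (x \in K').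
    rewrite V'_in //; apply/le_anti/andP; split.
      apply: le_ereal_inf_tmp => e /(min_le_offer xO).
      by rewrite (min_idPl (K'_le xK')).
    rewrite V_inf //; apply/ereal_inf_le_tmp/offersS.
    exact: finset.subsetUr.
  rewrite /V' /= xO xK' /=; apply/le_anti/andP; split.
    apply: le_ereal_inf_tmp => e /offersK'[offe|offe]; rewrite ge_min.
      by rewrite V_inf // (ereal_inf_lbound offe).
    by rewrite (ereal_inf_lbound offe) orbT.
  rewrite le_min V_inf //; apply/andP; split; apply: ereal_inf_le_tmp.
    exact/offersS/finset.subsetUr.
  exact: update_offers.
- move=> zK' /order'; rewrite (V'_in zK'); apply: le_trans (K'_le zK').
- by move=> zK'; rewrite V'_in // K'_fin.
- have [yK'|/order'] := boolP (y \in K').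
    by rewrite V'_in // (label_gtNy inv).
  by apply: lt_le_trans; apply: (label_gtNy inv xbar).
Qed.

End Accept.

Lemma invariant_reachable st :
  dijkstra_reachable Omega S f q st -> invariant st.
Proof.
elim=> [|[K V] xbar _ inv xbarK xbar_lt xbar_min]; first exact: invariant_init.
exact: invariant_accept.
Qed.

Lemma dijkstra_terminates : exists V, dijkstra_output Omega S f q V.
Proof.
suff run n K V : (#|~: K|%SET <= n)%N ->
    dijkstra_reachable Omega S f q (K, V) ->
    exists V', dijkstra_output Omega S f q V'.
  exact: run (leqnn _) (dijkstra_start _ _ _ _).
elim: n K V => [|n IH] K V Kn KV.
  exists V, K; split=> // y yK.
  by move: Kn; rewrite leqn0 cards_eq0 => /eqP/setP/(_ y); rewrite !inE yK.
have [|/existsPn Vall] := boolP [exists y, (y \notin K) && (V y < +oo)%E];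
  last first.
  exists V, K; split=> // y yK; apply/eqP.
  by have := Vall y; rewrite yK /= -leNgt leye_eq.
move=> /existsP[y /andP[yK Vy]].
pose xbar := [arg min_(z < y | z \notin K) V z]%O.
have [xbarK xbar_min] : xbar \notin K /\
    forall z, z \notin K -> (V xbar <= V z)%E.
  by rewrite /xbar; case: arg_minP.
have := dijkstra_step KV xbarK (le_lt_trans (xbar_min _ yK) Vy) xbar_min.
apply: IH; rewrite -ltnS; apply: leq_trans Kn.
apply/proper_card/properP; split.
  by rewrite finset.setCS; apply: finset.subsetUr.
by exists xbar; rewrite !inE ?eqxx.
Qed.

Hypothesis target_reachable : forall x, exists pi,
  admissible Omega S pi /\ reaches_target Omega pi x.

(** A node left out has no finite offer, although every vertex of its
    simplexes can be moved to with certainty; so these vertices are left out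
    as well, and no policy leads out of the set of such nodes. *)
Lemma dijkstra_accepts_all K V : dijkstra_reachable Omega S f q (K, V) ->
  (forall y, y \notin K -> V y = +oo%E) -> forall x, x \in K.
Proof.
move=> /invariant_reachable inv Voo x; apply: contraT => xK.
have left_interior y : y \notin K -> interior_node y.
  move=> yK; apply: contraT => yO.
  by have := label_boundary inv yO; rewrite /= Voo.
have left_closed y s j : y \notin K -> s \in S y -> s j \notin K.
  move=> yK sy; apply/negP => sjK.
  have := label_inf inv (left_interior y yK); rewrite /= Voo // => /esym.
  move=> /ereal_inf_pinfty/(_ (label_value V y s (delta_mx 0 j))).
  have off : offers K V y (label_value V y s (delta_mx 0 j)).
    exists s, (delta_mx 0 j); split=> //; first exact: Xi_delta.
    by move=> i; rewrite mxE /=; have [->//|] := eqVneq i j; rewrite ltxx.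
  move=> /(_ off); rewrite (label_valueE (U := fine \o V)) //.
    exact: Xi_delta.
  move=> i; rewrite mxE /=; have [->|_] := eqVneq i j; last by rewrite ltxx.
  by rewrite fineK // (label_fin inv sjK).
have [pi [api]] := target_reachable x.
have stuck N : forall pi y, admissible Omega S pi -> y \notin K ->
    unreached Omega N pi y = 1.
  elim: N => [//|N IH] {}pi y {}api yK; have yO := left_interior y yK.
  rewrite unreached_interior //; have [sy Xxi] := api 0%N y yO.
  rewrite -[RHS](weighted_sum_cst 1 Xxi); apply: eq_weighted_sum => // j _.
  by apply: IH (admissible_shift api) _; apply: left_closed sy.
rewrite /reaches_target; under eq_fun do rewrite stuck //.
move=> /cvg_lim; rewrite lim_cst // => /(_ (@Rhausdorff R))/eqP.
by rewrite oner_eq0.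
Qed.

Lemma dijkstra_output_HJB V : dijkstra_output Omega S f q V ->
  exists2 U : X -> R, forall x, V x = (U x)%:E &
  [/\ forall x, interior_node x -> is_min [set r | exists s xi,
        [/\ s \in S x, Xi xi & r = move_value U x s xi]] (U x)
    & forall x, ~~ interior_node x -> U x = q (fsval x)].
Proof.
move=> [K [KV Voo]]; have inK := dijkstra_accepts_all KV Voo.
have inv := invariant_reachable KV.
have VU x : V x = (fine (V x))%:E by rewrite fineK // (label_fin inv (inK x)).
exists (fun x => fine (V x)) => //; split=> x xO; last first.
  by have /= -> := label_boundary inv xO.
pose U x := fine (V x).
have U_le s xi : s \in S x -> Xi xi -> U x <= move_value U x s xi.
  move=> sx Xxi; rewrite -lee_fin -VU; have /= -> := label_inf inv xO.
  apply: ereal_inf_lbound; exists s, xi; split=> //.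
  by apply/esym/label_valueE.
split; last by move=> _ [s [xi [sx Xxi ->]]]; apply: U_le.
(* The infimum is attained: by causality on each simplex, and the simplexes
   are finitely many. *)
have /choice[g gP] : forall s, exists xi : 'rV[R]_m, s \in S x -> Xi xi /\
    forall xi', Xi xi' -> move_value U x s xi <= move_value U x s xi'.
  move=> s; have [sx|] := boolP (s \in S x); last by exists 0.
  by have [xi [Xxi ximin _]] := causal xO sx (U \o s); exists xi.
have [pi [api _]] := target_reachable x; have [s0x _] := api 0%N x xO.
have [s sx smin] := arg_minP (fun s => move_value U x s (g s)) s0x.
exists s, (g s); have [Xg gmin] := gP s sx; split=> //.
apply/le_anti; rewrite U_le //= -lee_fin -VU; have /= -> := label_inf inv xO.
apply: le_ereal_inf_tmp => _ [s' [xi [s'x Xxi _ ->]]].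
rewrite (label_valueE (U := U)) // lee_fin.
by apply: le_trans (smin _ s'x) _; case: (gP s' s'x) => _; apply.
Qed.

End ShortestPath.

(** * Euclidean norm and directions *)

Section EuclideanNorm.
Context {R : realType} {m : nat}.
Implicit Types (v w : 'rV[R]_m) (a : R).

Lemma enorm_ge0 v : 0 <= enorm v.
Proof. exact: sqrtr_ge0. Qed.

Lemma enormZ a v : enorm (a *: v) = `|a| * enorm v.
Proof.
rewrite /enorm -sqrtr_sqr -sqrtrM ?sqr_ge0 // mulr_sumr; congr Num.sqrt.
by apply: eq_bigr => i _; rewrite mxE exprMn.
Qed.

Lemma enorm_eq0 v : (enorm v == 0) = (v == 0).
Proof.
apply/idP/eqP => [|->]; last first.
  by rewrite /enorm big1 ?sqrtr0 // => i _; rewrite mxE expr0n.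
rewrite sqrtr_eq0 => v_le0; apply/rowP => i; rewrite mxE; apply/eqP.
rewrite -sqrf_eq0 eq_le sqr_ge0 andbT; apply: le_trans v_le0.
by rewrite (bigD1 i) //= lerDl sumr_ge0 // => j _; exact: sqr_ge0.
Qed.

Lemma enorm_gt0 v : (0 < enorm v) = (v != 0).
Proof. by rewrite lt0r enorm_ge0 enorm_eq0 andbT. Qed.

Lemma direction_sphere v : v != 0 -> sphere (direction v).
Proof.
rewrite -enorm_gt0 => v0; rewrite /sphere /= enormZ ger0_norm ?invr_ge0 ?ltW//.
by rewrite mulVf ?gt_eqF.
Qed.

Lemma scale_direction v : enorm v *: direction v = v.
Proof.
have [->|v0] := eqVneq v 0; first by rewrite /direction !scaler0.
by rewrite scalerA mulfV ?scale1r // enorm_eq0.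
Qed.

Lemma enorm_continuous : continuous (@enorm R m).
Proof.
have sum_sqr : continuous (fun w : 'rV[R]_m => \sum_(i < m) w 0 i ^+ 2).
  apply: (continuous_big (op := +%R)) => [|i _ w]; first exact: add_continuous.
  apply: (continuous_comp (f := fun w : 'rV[R]_m => w 0 i)
    (g := fun t : R => t ^+ 2)).
    exact: coord_continuous.
  exact: exprn_continuous.
by move=> v; apply: continuous_comp; [exact: sum_sqr | exact: sqrt_continuous].
Qed.

Lemma direction_continuous v : v != 0 -> {for v, continuous (@direction R m)}.
Proof.
move=> v0; apply: (@cvgZ _ _ _ (nbhs v)); last exact: cvg_id.
by apply: cvgV; [rewrite enorm_eq0 | exact: enorm_continuous].
Qed.

End EuclideanNorm.

(** * Cost of a simplex *)

Section SimplexCost.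
Context {R : realType} {m : nat}.
Variables (f : 'rV[R]_m -> 'rV[R]_m -> R) (x : 'rV[R]_m).
Implicit Types (z : 'I_m -> 'rV[R]_m) (xi : 'rV[R]_m) (v : 'rV[R]_m).
Implicit Types (theta eta : 'I_m -> R).

Hypothesis f_gt0 : forall a, sphere a -> 0 < f x a.

(** Travel time along the displacement [v] at the speed in its direction: the
    gauge of the speed profile. *)
Definition travel_time v : R := enorm v / f x (direction v).

Lemma travel_time_gt0 v : v != 0 -> 0 < travel_time v.
Proof.
by move=> v0; rewrite divr_gt0 ?enorm_gt0 ?f_gt0 //; exact: direction_sphere.
Qed.

Lemma travel_time_profile v : v != 0 ->
  speed_profile f x ((travel_time v)^-1 *: v).
Proof.
move=> v0; exists (direction v); first exact: direction_sphere.
by rewrite /travel_time invf_div -scalerA.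
Qed.

Lemma travel_time_velocity z j : z j - x != 0 ->
  z j - x = travel_time (z j - x) *: velocity f x z j.
Proof.
move=> v0; rewrite /velocity scalerA divfK ?scale_direction //.
by rewrite gt_eqF // f_gt0 //; exact: direction_sphere.
Qed.

Lemma bary_subr z xi : Xi xi ->
  bary z xi - x = \sum_(j < m) xi 0 j *: (z j - x).
Proof.
move=> [_ xi1]; rewrite -[X in _ - X]scale1r -xi1 scaler_suml -sumrB.
by apply: eq_bigr => j _; rewrite scalerBr.
Qed.

Lemma bary_continuous z : continuous (bary z).
Proof.
apply: (@continuous_big 'rV[R]_m _ +%R 0 xpredT add_continuous 'rV[R]_m
  (index_enum _) (fun j xi => xi 0 j *: z j)) => j _ xi.
by apply: (cvgZr_tmp (F := nbhs xi)); exact: coord_continuous.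
Qed.

Lemma cost_delta z j : cost f x z (delta_mx 0 j) = travel_time (z j - x).
Proof.
rewrite /cost /bary (bigD1 j) //= mxE !eqxx scale1r big1 ?addr0 // => i ij.
by rewrite mxE (negPf ij) andbF scale0r.
Qed.

Section Nondegenerate.
Variable z : 'I_m -> 'rV[R]_m.
Hypothesis z_free : nondegenerate_simplex x z.

Let Z := \matrix_(j < m) (z j - x).

Lemma edges_mulmx theta :
  \sum_(j < m) theta j *: (z j - x) = (\row_j theta j) *m Z.
Proof. by rewrite mulmx_sum_row; apply: eq_bigr => j _; rewrite mxE rowK. Qed.

Lemma edges_free theta eta :
  \sum_(j < m) theta j *: (z j - x) = \sum_(j < m) eta j *: (z j - x) ->
  theta =1 eta.
Proof.
rewrite !edges_mulmx => /(row_free_inj z_free)/rowP + j => /(_ j).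
by rewrite !mxE.
Qed.

Lemma edges_span v : exists theta, v = \sum_(j < m) theta j *: (z j - x).
Proof.
exists (fun j => (v *m invmx Z) 0 j); rewrite edges_mulmx.
rewrite (_ : \row_j _ = v *m invmx Z); last by apply/rowP => j; rewrite mxE.
by rewrite mulmxKV // -row_free_unit.
Qed.

Lemma edge_neq0 j : z j - x != 0.
Proof.
apply/eqP => zj0.
have /edges_free/(_ j)/eqP : \sum_(i < m) (i == j)%:R *: (z i - x) =
    \sum_(i < m) 0 *: (z i - x).
  apply: eq_bigr => i _; have [->|_] := eqVneq i j; last by [].
  by rewrite zj0 !scaler0.
by rewrite eqxx oner_eq0.
Qed.

Lemma edges_velocity theta : \sum_(j < m) theta j *: (z j - x) =
  \sum_(j < m) (theta j * travel_time (z j - x)) *: velocity f x z j.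
Proof.
apply: eq_bigr => j _.
by rewrite {1}(travel_time_velocity (edge_neq0 j)) scalerA.
Qed.

Lemma velocity_edges theta : \sum_(j < m) theta j *: velocity f x z j =
  \sum_(j < m) (theta j / travel_time (z j - x)) *: (z j - x).
Proof.
rewrite edges_velocity; apply: eq_bigr => j _.
by rewrite divfK // gt_eqF // travel_time_gt0 // edge_neq0.
Qed.

Lemma velocity_free theta eta :
  \sum_(j < m) theta j *: velocity f x z j =
  \sum_(j < m) eta j *: velocity f x z j -> theta =1 eta.
Proof.
rewrite !velocity_edges => /edges_free te j.
by apply: (divIf _ (te j)); rewrite gt_eqF // travel_time_gt0 // edge_neq0.
Qed.

Lemma displacement_neq0 xi : Xi xi -> bary z xi - x != 0.
Proof.
move=> Xxi; rewrite bary_subr //; apply/eqP => xi0.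
have [j] := Xi_support Xxi; suff -> : xi 0 j = 0 by rewrite ltxx.
apply: (edges_free (theta := fun j => xi 0 j) (eta := fun=> 0)).
by rewrite xi0 big1 // => i _; rewrite scale0r.
Qed.

Lemma cost_gt0 xi : Xi xi -> 0 < cost f x z xi.
Proof. by move=> /displacement_neq0/travel_time_gt0. Qed.

(** The displacement towards [bary z xi] covered in unit time lies on the
    profile; its coordinates along the velocities [v_j] are the shares
    [xi_j * C(e_j) / C(xi)] of the cost. *)
Lemma displacement_profile xi : Xi xi ->
  let theta j := xi 0 j * cost f x z (delta_mx 0 j) / cost f x z xi in
  simplex_profile f x z (\sum_(j < m) theta j *: velocity f x z j).
Proof.
move=> Xxi theta; have C0 := cost_gt0 Xxi; split; last first.
  exists theta; split=> // j; rewrite /theta divr_ge0 ?(ltW C0) // mulr_ge0 //.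
    by case: Xxi.
  exact/ltW/cost_gt0/Xi_delta.
rewrite (_ : \sum_(j < m) _ = (cost f x z xi)^-1 *: (bary z xi - x)).
  exact/travel_time_profile/displacement_neq0.
rewrite bary_subr // (edges_velocity (fun j => xi 0 j)) scaler_sumr.
by apply: eq_bigr => j _; rewrite [RHS]scalerA /theta cost_delta mulrC.
Qed.

(** A component of a move costs at most the move itself, its share of the cost
    being a coordinate of a point of the profile. *)
Lemma cost_ge_component xi j :
  simplex_profile f x z `<=` [set v | exists2 theta : 'I_m -> R,
    forall j, theta j <= 1 & v = \sum_(j < m) theta j *: velocity f x z j] ->
  Xi xi -> xi 0 j * cost f x z (delta_mx 0 j) <= cost f x z xi.
Proof.
move=> sub Xxi; have [theta theta1] := sub _ (displacement_profile Xxi).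
move=> /velocity_free/(_ j) thetaE; have := theta1 j.
by rewrite -thetaE ler_pdivrMr ?mul1r // cost_gt0.
Qed.

Hypothesis f_lip : exists M, forall a b, sphere a -> sphere b ->
  `|f x a - f x b| <= M * `|a - b|.

Lemma travel_time_continuous v : v != 0 -> {for v, continuous travel_time}.
Proof.
move=> v0.
apply: (cvgM (F := nbhs v) (f := @enorm R m)
  (g := fun w => (f x (direction w))^-1)).
  exact: enorm_continuous.
apply: cvgV; first by rewrite gt_eqF // f_gt0 //; exact: direction_sphere.
have [M fM] := f_lip; apply/cvgrPdist_lt => e e0.
have M1 : 0 < `|M| + 1 by rewrite ltr_wpDl.
have := direction_continuous v0; move=> /cvgrPdist_lt/(_ (e / (`|M| + 1))).
move=> /(_ (divr_gt0 e0 M1)) near_dir.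
near=> w.
have w0 : w != 0.
  by near: w; apply: (@cvgr_neq0 _ _ _ (nbhs v) _ id v) => //; exact: cvg_id.
apply: le_lt_trans (fM _ _ (direction_sphere v0) (direction_sphere w0)) _.
apply: (@le_lt_trans _ _ ((`|M| + 1) * `|direction v - direction w|)).
  by rewrite ler_wpM2r // (le_trans (ler_norm _)) // lerDl.
by rewrite mulrC -ltr_pdivlMr //; near: w.
Unshelve. all: by end_near. Qed.

Lemma cost_continuous xi : Xi xi -> {for xi, continuous (cost f x z)}.
Proof.
move=> Xxi.
apply: (continuous_comp (f := fun xi => bary z xi - x) (g := travel_time));
  last first.
  exact/travel_time_continuous/displacement_neq0.
apply: (cvgB (F := nbhs xi)); last exact: cvg_cst.
exact: bary_continuous.
Qed.

End Nondegenerate.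
End SimplexCost.

Lemma Xi_compact (R : realType) m : compact (@Xi R m).
Proof.
have sum_cont : continuous (fun xi : 'rV[R]_m => \sum_(j < m) xi 0 j).
  apply: (continuous_big (op := +%R)) => [|i _ w]; first exact: add_continuous.
  exact: coord_continuous.
have -> : @Xi R m = [set xi : 'rV[R]_m | forall j, `[0, 1]%classic (xi 0 j)] `&`
    (fun xi : 'rV[R]_m => \sum_(j < m) xi 0 j) @^-1` [set x | x = 1].
  apply/seteqP; split=> xi [xi0 xi1]; split=> // j.
    by rewrite /= in_itv /= xi0 -xi1 (bigD1 j) //= lerDl sumr_ge0.
  by have := xi0 j; rewrite /= in_itv => /andP[].
apply: compact_closedI.
  apply: (@rV_compact _ _ (fun=> `[0 : R, 1]%classic)) => j.
  exact: segment_compact.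
by apply: preimage_closed => [xi _|]; [exact: sum_cont | exact: closed_eq].
Qed.

Lemma cost_minimizer (R : realType) m (f : 'rV[R]_m -> 'rV[R]_m -> R) x z :
  (forall a, sphere a -> 0 < f x a) ->
  (exists M, forall a b, sphere a -> sphere b ->
    `|f x a - f x b| <= M * `|a - b|) ->
  nondegenerate_simplex x z -> 'I_m -> forall W : 'I_m -> R,
  exists2 xi : 'rV[R]_m, Xi xi & forall xi', Xi xi' ->
    cost f x z xi + \sum_(j < m) xi 0 j * W j <=
    cost f x z xi' + \sum_(j < m) xi' 0 j * W j.
Proof.
move=> f_gt0 f_lip z_free k W.
have W_cont : continuous (fun xi : 'rV[R]_m => \sum_(j < m) xi 0 j * W j).
  apply: (continuous_big (op := +%R)) => [|j _ xi]; first exact: add_continuous.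
  by apply: (cvgMr_tmp (F := nbhs xi)); exact: coord_continuous.
have [] := @EVT_min_rV R m
  (fun xi => cost f x z xi + \sum_(j < m) xi 0 j * W j) Xi.
- by exists (delta_mx 0 k); exact: Xi_delta.
- exact: Xi_compact.
- apply: continuous_in_subspaceT => xi; rewrite inE => Xxi.
  apply: (cvgD (F := nbhs xi)); last exact: W_cont.
  exact: (cost_continuous f_gt0 z_free f_lip).
- move=> xi; rewrite inE => Xxi ximin; exists xi => // xi' Xxi'.
  by apply: ximin; rewrite inE.
Qed.
(** * The parallelogram condition in the plane *)

Section Planar.
Context {R : realType}.

Lemma I2_other (j k l : 'I_2) : k != l -> j != k -> j = l.
Proof.
case: k l j => [[|[|//]] ?] [[|[|//]] ?] [[|[|//]] ?] //= _ _.
  exact: val_inj.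
exact: val_inj.
Qed.

Lemma sum_I2 (V : nmodType) (k l : 'I_2) (F : 'I_2 -> V) : k != l ->
  \sum_(j < 2) F j = F k + F l.
Proof.
move=> kl; rewrite (bigD1 k) //=; congr (_ + _); apply: big_pred1 => i.
by apply/idP/eqP => [/(I2_other kl)|->] //; rewrite eq_sym.
Qed.

Lemma parallelogramE (f : 'rV[R]_2 -> 'rV[R]_2 -> R) x z :
  simplex_parallelogram f x z =
  [set v | exists2 theta : 'I_2 -> R, forall j, 0 <= theta j <= 1 &
     v = \sum_(j < 2) theta j *: velocity f x z j].
Proof.
have sumE (F : 'I_2 -> 'rV[R]_2) : \sum_(j < 2) F j = F ord0 + F ord_max.
  exact: sum_I2.
apply/seteqP; split=> v.
  move=> [t1 [t2 [t1P t2P ->]]].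
  exists (fun j => if j == ord0 then t1 else t2) => [j|]; first by case: ifP.
  by rewrite sumE.
move=> [theta thetaP ->]; exists (theta ord0), (theta ord_max).
by rewrite sumE.
Qed.

(** Let [k] have the smaller vertex value and [l] the larger one, with
    difference [D], and let [xi] be optimal. If moving to [k] directly is not
    optimal, then [C(xi) + xi_l D < C(e_k)], and
    [xi_k C(e_k) <= C(xi)] forces [D < C(e_k)], whence [xi_k D < C(xi)], which
    is causality at [l]. *)
Lemma causal_of_cost_ge_component (f : 'rV[R]_2 -> 'rV[R]_2 -> R) x z :
  (forall xi, Xi xi -> 0 < cost f x z xi) ->
  (forall xi j, Xi xi ->
    xi 0 j * cost f x z (delta_mx 0 j) <= cost f x z xi) ->
  (forall W : 'I_2 -> R, exists2 xi : 'rV[R]_2, Xi xi & forall xi', Xi xi' ->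
    cost f x z xi + \sum_(j < 2) xi 0 j * W j <=
    cost f x z xi' + \sum_(j < 2) xi' 0 j * W j) ->
  monotone_causal f x z.
Proof.
move=> C_gt0 C_ge C_min W.
have [k [l [kl Wkl]]] : exists k l : 'I_2, k != l /\ W k <= W l.
  have [W01|/ltW W10] := leP (W ord0) (W ord_max).
    by exists ord0, ord_max.
  by exists ord_max, ord0.
have [xi Xxi ximin] := C_min W.
pose val (xi : 'rV[R]_2) := cost f x z xi + \sum_(j < 2) xi 0 j * W j.
have val_k : val (delta_mx 0 k) = cost f x z (delta_mx 0 k) + W k.
  rewrite /val (sum_I2 _ kl) !mxE !eqxx eq_sym (negPf kl) /=.
  by rewrite mul1r mul0r addr0.
have [k_le|xi_lt] := leP (val (delta_mx 0 k)) (val xi).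
  exists (delta_mx 0 k); split; first exact: Xi_delta.
    by move=> xi' /ximin; apply: le_trans k_le.
  move=> j; rewrite mxE /=; have [-> _|] := eqVneq j k; last by rewrite ltxx.
  by rewrite -/(val _) val_k ltrDr C_gt0 //; exact: Xi_delta.
exists xi; split=> // j xij; rewrite -/(val xi).
have [xi_ge0 xi_sum] := Xxi; rewrite (sum_I2 _ kl) in xi_sum.
have valE : val xi = cost f x z xi + (xi 0 k * W k + xi 0 l * W l).
  by rewrite /val (sum_I2 _ kl).
have := C_gt0 _ Xxi; have := C_gt0 _ (Xi_delta k).
have := C_ge _ k Xxi; have := xi_ge0 k; have := xi_ge0 l.
move: xi_lt; rewrite val_k valE (_ : xi 0 k = 1 - xi 0 l); last first.
  by rewrite -xi_sum addrK.
set C := cost _ _ _ xi; set b := xi 0 l; set c := cost _ _ _ _.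
move=> C_lt b_ge0 b_le1 c_le c_gt0 C_gt0'.
have bD : 0 <= b * (W l - W k) by rewrite mulr_ge0 ?subr_ge0.
have [->|jk] := eqVneq j k; first by lra.
have jl := I2_other kl jk.
rewrite jl -/b in xij *.
have Dc : W l - W k < c by rewrite -(ltr_pM2l xij); lra.
have [b1|] := ltP b 1; last by nra.
suff : (1 - b) * (W l - W k) < (1 - b) * c by lra.
by rewrite ltr_pM2l ?subr_gt0.
Qed.

Lemma causal_of_parallelogram (f : 'rV[R]_2 -> 'rV[R]_2 -> R) x z :
  (forall a, sphere a -> 0 < f x a) ->
  (exists M, forall a b, sphere a -> sphere b ->
    `|f x a - f x b| <= M * `|a - b|) ->
  nondegenerate_simplex x z ->
  simplex_profile f x z `<=` simplex_parallelogram f x z ->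
  monotone_causal f x z.
Proof.
move=> f_gt0 f_lip z_free; rewrite parallelogramE => sub.
apply: causal_of_cost_ge_component => [xi|xi j|W].
- exact: cost_gt0.
- apply: cost_ge_component => //; apply: subset_trans sub _.
  move=> _ [theta theta01 ->]; exists theta => // i.
  by case/andP: (theta01 i).
- exact: cost_minimizer ord0 W.
Qed.

End Planar.

(** * Stencils and the speed profile *)

Section StencilProfile.
Context {R : realType}.

(** An interior direction of one simplex remains interior after a small shift
    towards the interior of the other. *)
Lemma nonoverlapping_interior m (X : {fset 'rV[R]_m})
    (S : X -> {set simplex X}) (x : X) s s' (theta theta' : 'I_m -> R) :
  stencil_nonoverlapping S x -> s \in S x -> s' \in S x -> s <> s' ->
  nondegenerate_simplex (fsval x) (vertices s) ->
  (forall j, 0 < theta j) -> (forall j, 0 <= theta' j) ->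
  \sum_(j < m) theta j *: (vertices s j - fsval x) <>
  \sum_(j < m) theta' j *: (vertices s' j - fsval x).
Proof.
move=> nov sx s'x ss' s_free theta0 theta'0 eq_theta.
have [b bE] := edges_span s_free (\sum_(j < m) (vertices s' j - fsval x)).
pose e := \big[Order.min/1]_j (theta j / (`|b j| + 1)).
have b1 j : 0 < `|b j| + 1 by rewrite ltr_wpDl.
have e0 : 0 < e by apply: lt_bigmin => // j _; rewrite divr_gt0.
have eb j : 0 < theta j + e * b j.
  have : e <= theta j / (`|b j| + 1) by apply: bigmin_le.
  have : 0 <= e * (`|b j| + b j).
    by rewrite mulr_ge0 ?(ltW e0) // -lerBlDr sub0r -normrN ler_norm.
  by rewrite ler_pdivlMr //; lra.
apply: (nov s s' sx s'x ss' _ (fun j => theta' j + e) eb) => [j|].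
  by rewrite ltr_wpDl.
under eq_bigr do rewrite scalerDl -scalerA.
under [RHS]eq_bigr do rewrite scalerDl.
by rewrite !big_split /= eq_theta -!scaler_sumr -bE.
Qed.

Lemma profile_sub_parallelograms (f : 'rV[R]_2 -> 'rV[R]_2 -> R)
    (X : {fset 'rV[R]_2}) (S : X -> {set simplex X}) (x : X) :
  (forall a, sphere a -> 0 < f (fsval x) a) ->
  stencil_nondegenerate S x -> stencil_covers S x ->
  (forall s, s \in S x -> simplex_profile f (fsval x) (vertices s) `<=`
    simplex_parallelogram f (fsval x) (vertices s)) ->
  speed_profile f (fsval x) `<=` \bigcup_(s in [set` S x])
    simplex_parallelogram f (fsval x) (vertices s).
Proof.
move=> f_gt0 nd cov sub v [a a1 <-].
have [s [sx [theta [theta0 aE]]]] := cov a a1.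
exists s => //; apply: sub => //; split; first by exists a.
exists (fun j => f (fsval x) a * (theta j *
  travel_time f (fsval x) (vertices s j - fsval x))); split=> [j|].
  rewrite mulr_ge0 ?(ltW (f_gt0 _ a1)) // mulr_ge0 //.
  by rewrite ltW // travel_time_gt0 //; apply: edge_neq0 (nd s sx) j.
rewrite {2}aE (edges_velocity f_gt0 (nd s sx)) scaler_sumr.
by apply: eq_bigr => j _; rewrite [LHS]scalerA.
Qed.

(** The profile meets a ray in a single point. *)
Lemma profile_ray m (f : 'rV[R]_m -> 'rV[R]_m -> R) x z j (t : R) :
  (forall a, sphere a -> 0 < f x a) -> z j - x != 0 -> 0 <= t ->
  speed_profile f x (t *: velocity f x z j) -> t = 1.
Proof.
move=> f_gt0 zj t_ge0 [a a1]; rewrite /velocity scalerA.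
set d := direction (z j - x) => faE.
have d1 : sphere d by exact: direction_sphere.
have fd := f_gt0 _ d1; have fa := f_gt0 _ a1.
have /(congr1 enorm) := faE.
rewrite (enormZ (f x a)) (enormZ (t * _)) a1 d1 !mulr1 (gtr0_norm fa).
rewrite ger0_norm ?mulr_ge0 ?(ltW fd) // => fat.
have ad : a = d.
  by have := faE; rewrite -fat => /(scalerI (lt0r_neq0 fa)).
move: fat; rewrite ad => /esym/eqP; rewrite -subr_eq0 -{2}[f x d]mul1r -mulrBl.
by rewrite mulf_eq0 (gt_eqF fd) orbF subr_eq0 => /eqP.
Qed.

Lemma profile_in_parallelogram (f : 'rV[R]_2 -> 'rV[R]_2 -> R)
    (X : {fset 'rV[R]_2}) (S : X -> {set simplex X}) (x : X) :
  (forall a, sphere a -> 0 < f (fsval x) a) ->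
  stencil_nondegenerate S x -> stencil_nonoverlapping S x ->
  speed_profile f (fsval x) `<=` \bigcup_(s in [set` S x])
    simplex_parallelogram f (fsval x) (vertices s) ->
  forall s, s \in S x -> simplex_profile f (fsval x) (vertices s) `<=`
    simplex_parallelogram f (fsval x) (vertices s).
Proof.
move=> f_gt0 nd nov cover s sx v [vV [theta [theta0 vE]]].
have edge s' j (s'x : s' \in S x) := edge_neq0 (nd s' s'x) j.
have [theta_gt0|/existsNP[k]] := pselect (forall j, 0 < theta j).
  (* [v] is interior to the cone of [s], so the union can only cover it by the
     parallelogram of [s] itself. *)
  have [s' /= s'x] := cover v vV.
  have [->//|ss'] := eqVneq s s'; rewrite parallelogramE.
  move=> [theta' theta'01]; rewrite vE.
  rewrite (velocity_edges f_gt0 (nd s sx)) (velocity_edges f_gt0 (nd s' s'x)).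
  move=> eq_v; exfalso; apply: (nonoverlapping_interior nov) eq_v => //.
  - exact/eqP.
  - exact: nd.
  - by move=> j; rewrite divr_gt0 // travel_time_gt0 // edge.
  - move=> j; have /andP[? _] := theta'01 j.
    by rewrite divr_ge0 // ltW // travel_time_gt0 // edge.
(* Otherwise [v] is on an edge ray of [s], hence it is one of the velocities. *)
move=> /negP; rewrite -leNgt => theta_le0.
have theta_k : theta k = 0 by apply/le_anti; rewrite theta_le0 theta0.
have [l kl] : exists l, k != l.
  by have [->|k0] := eqVneq k ord0; [exists ord_max | exists ord0].
have vl : v = theta l *: velocity f (fsval x) (vertices s) l.
  by rewrite vE (sum_I2 _ kl) theta_k scale0r add0r.
have thetal : theta l = 1.
  by apply: (profile_ray f_gt0 (edge s l sx) (theta0 l)); rewrite -vl.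
rewrite parallelogramE; exists theta => // j; rewrite theta0 /=.
have [->|jl] := eqVneq j l; first by rewrite thetal.
have lk : l != k by rewrite eq_sym.
by rewrite (I2_other lk jl) theta_k ler01.
Qed.

End StencilProfile.

Theorem theorem14 (R : realType) (Omega : set 'rV[R]_2)
    (f : 'rV[R]_2 -> 'rV[R]_2 -> R) (F1 F2 : R) (q : 'rV[R]_2 -> R)
    (X : {fset 'rV[R]_2}) (S : X -> {set simplex X})
    (Omega_open : open Omega)
    (f_lipschitz : [lipschitz (f p.1 p.2 : R^o) | p in Omega `*` sphere])
    (F1_gt0 : 0 < F1)
    (f_bounds : forall x a, Omega x -> sphere a -> F1 <= f x a <= F2)
    (q_lipschitz : [lipschitz (q x : R^o) | x in boundary Omega])
    (q_ge0 : forall x, boundary Omega x -> 0 <= q x)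
    (X_closure : forall x : X, closure Omega (fsval x))
    (S_nondegenerate : forall x, interior_node Omega x ->
       stencil_nondegenerate S x)
    (S_covers : forall x, interior_node Omega x -> stencil_covers S x)
    (target_reachable : forall x : X, exists pi,
       admissible Omega S pi /\ reaches_target Omega pi x) :
  [/\ forall (x : 'rV[R]_2) (z : 'I_2 -> 'rV[R]_2),
        Omega x -> nondegenerate_simplex x z ->
        simplex_profile f x z `<=` simplex_parallelogram f x z ->
        monotone_causal f x z,
      forall x : X, interior_node Omega x ->
        let P s := simplex_parallelogram f (fsval x) (vertices s) in
        let property := forall s, s \in S x ->
          simplex_profile f (fsval x) (vertices s) `<=` P s in
        let profile_in_union :=
          speed_profile f (fsval x) `<=` \bigcup_(s in [set` S x]) P s in
        [/\ property -> stencil_monotone_causal S f x,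
            property -> profile_in_union
          & stencil_nonoverlapping S x -> profile_in_union -> property]
    & (forall x, interior_node Omega x -> stencil_monotone_causal S f x) ->
      dijkstra_applicable Omega S f q].
Proof.
have f_gt0 x a : Omega x -> sphere a -> 0 < f x a.
  move=> Ox a1; have /andP[F1f _] := f_bounds x a Ox a1.
  exact: lt_le_trans F1f.
have f_lip x : Omega x -> exists M, forall a b, sphere a -> sphere b ->
    `|f x a - f x b| <= M * `|a - b|.
  move=> Ox; move: f_lipschitz; rewrite /lipschitz_on => /pinfty_ex_gt0[M _ fM].
  exists M => a b a1 b1.
  have := fM ((x, a), (x, b)); rewrite /= prod_normE /= subrr normr0.
  by rewrite (max_idPr (normr_ge0 _)); apply.
have node (x : X) : interior_node Omega x -> Omega (fsval x).
  by rewrite /interior_node inE.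
have causal_simplex (x : 'rV[R]_2) z : Omega x -> nondegenerate_simplex x z ->
    simplex_profile f x z `<=` simplex_parallelogram f x z ->
    monotone_causal f x z.
  move=> Ox; apply: causal_of_parallelogram; last exact: f_lip.
  by move=> a; exact: f_gt0.
split=> // [x xO P property profile_in_union | causal].
  have Ox := node x xO; have nd := S_nondegenerate x xO.
  split=> [prop s sx|prop|nov cover].
  - by apply: causal_simplex => //; [exact: nd | exact: prop].
  - by apply: profile_sub_parallelograms prop => //;
      [move=> a; exact: f_gt0 | exact: S_covers].
  - by apply: profile_in_parallelogram cover => // a; exact: f_gt0.
have boundaryE (x : X) : boundary Omega (fsval x) <-> ~~ interior_node Omega x.
  rewrite /boundary (interior_id Omega).1 // /interior_node notin_setE.
  by split=> [[]//|nOx]; split=> //; exact: X_closure.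
have q_node (x : X) : ~~ interior_node Omega x -> 0 <= q (fsval x).
  by move=> /boundaryE/q_ge0.
have optimal U : discrete_HJB Omega S f q U ->
    forall x, optimal_cost Omega S f q x = (U x)%:E.
  move=> [U_int U_bd] x; apply: optimal_cost_value => // y /boundaryE.
  exact: U_bd.
have output V : dijkstra_output Omega S f q V -> exists2 U : X -> R,
    forall x, V x = (U x)%:E & discrete_HJB Omega S f q U.
  move=> /(dijkstra_output_HJB causal target_reachable)[U VU [U_int U_bd]].
  by exists U => //; split=> // x /boundaryE/U_bd.
have [V outV] := dijkstra_terminates Omega S f q.
have [U VU HJBU] := output V outV.
have unique U' : discrete_HJB Omega S f q U' -> U' =1 U.
  move=> HJBU' x; apply/EFin_inj.
  by rewrite -(optimal U' HJBU') -(optimal U HJBU).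
exists U; split=> //.
- exact: optimal.
- by exists V.
- by move=> V' /output[U' V'U' /unique UU'] x; rewrite V'U' UU'.
Qed.
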